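(* Let $M=\{\mathcal A,\mathcal H,ds\}$ be a spectral geometry on a compact metric space $(X,|\cdot|)$. Assume that a sequence $\{\rho_i\}$ of marked spectra of bounded deformations of $M$ converges in the weak $L^p$-topology to the marked spectrum $\rho_0$ of a bounded deformation of $M$. If $p>\dim M$, then the associated Connes metrics $d_{\rho_i}$ on $X$ converge in the Lipschitz topology to $d_{\rho_0}$, i.e. $|d_{\rho_i}d_{\rho_0}|_L\to0$ as $i\to\infty$. In particular, if $\dim M<2$, then the convergence of marked spectra in the weak topology (the weak $L^2$-topology) implies the convergence of the associated Connes metrics in the Lipschitz topology.
   Context: $|xy|$ is the distance in $X$; $\Delta\subset X^2$ is the diagonal; $|b|=|yy'|$ for $b=(y,y')$. Spectral geometry (in the concrete form to which every axiomatically defined one is isomorphic): a triple $M=M(B,m)=\{\mathcal A,\mathcal H,ds\}$ where $B\subset X^2\setminus\Delta$ (the support) is symmetric under $(y,y')\mapsto(y',y)$ and $\{b\in B:|b|\ge t\}$ is finite for each $t>0$; $m:B\to\mathbb N$ is a symmetric function; $\mathcal H$ consists of square-summable sections $\xi$ on $B$, $\xi(y,y')\in\mathbb C^{m(y,y')}$; $\mathcal A$ is the algebra of Lipschitz functions on $X$ acting by $(\pi(a)\xi)(y,y')=a(y)\xi(y,y')$; $(ds\,\xi)(y,y')=|yy'|\xi(y',y)$. Bounded deformation: a positive symmetric function $\rho:B\to\mathbb R$ (the marked spectrum) such that $\rho(y,y')/|yy'|$ is bounded and separated from zero on $B$; $(ds_\rho\xi)(y,y')=\rho(y,y')\xi(y',y)$,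 $\mathcal D_\rho=ds_\rho^{-1}$, so $(\mathcal D_\rho\xi)(y,y')=\rho(y,y')^{-1}\xi(y',y)$. The Connes metric is $d_\rho(x,x')=\sup\{|a(x)-a(x')|:a\in\mathcal A,\ \|[\mathcal D_\rho,\pi(a)]\|\le1\}\in[0,\infty]$, where $\|[\mathcal D_\rho,\pi(a)]\|=\sup_{(y,y')\in B}|a(y)-a(y')|/\rho(y,y')$. Weak $L^p$-topology ($p>0$): $L^p(B)$ is the space of sections $\xi$ on $B$, $\xi(y,y')\in\mathbb C^{m(y,y')}$, with $\|\xi\|_p^p=\sum_{(y,y')\in B}\|\xi(y,y')\|^p<\infty$. The weak $L^p$-topology is the topology of pointwise convergence of the operators $\mathcal D_\rho$ on arbitrary elements of $L^p(B)$: $\rho_i\to\rho_0$ means that for every $\xi\in L^p(B)$ $$\sum_{(y,y')\in B}\left|\frac1{\rho_i(y,y')}-\frac1{\rho_0(y,y')}\right|^p\|\xi(y,y')\|^p\to0$$ (the sums being allowed to be infinite for finitely many $i$). For $p=2$ it is called the weak topology. Dixmier trace: $\omega$ is a fixed generalized limit (dilation-invariant state on bounded sequences extending the ordinary limit). For positive bounded diagonalizable $T$ with eigenvalues $\mu_0\ge\mu_1\ge\dots$ (with multiplicity, padded by zeros), $\sigma_N(T)=\sum_{n<N}\mu_n$; $\mathrm{Tr}_\omega(T)=\lim_\omega\sigma_N(T)/\log N$ if $\sigma_N(T)/\log N$ is bounded, $\infty$ otherwise. Dimension of $M$: $\dim M=\sup\{p\ge0:\mathrm{Tr}_\omega(|ds|^p)=\infty\}=\inf\{p\ge0:\mathrm{Tr}_\omega(|ds|^p)=0\}$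 (with $\sup\emptyset=0$, $\inf\emptyset=\infty$; the two coincide). Lipschitz distance: $|dd'|_L=\sup_{x\ne y}|\log(d'(x,y)/d(x,y))|$; pairs at which both $d$ and $d'$ are infinite contribute $0$. *)

(* Defs.v *)
From HB Require Import structures.
From mathcomp Require Import all_boot all_order all_algebra.
From mathcomp Require Import complex.
From mathcomp Require Import all_classical all_reals all_analysis.
Import numFieldNormedType.Exports.
Set Implicit Arguments.
Unset Strict Implicit.
Unset Printing Implicit Defensive.
Import Order.TTheory GRing.Theory Num.Theory.
Local Open Scope classical_set_scope.
Local Open Scope ring_scope.
Local Open Scope complex_scope.

Definition cmod {R : rcfType} (z : R[i]) : R := ComplexField.Normc.normc z.

Definition vnorm {R : rcfType} (n : nat) (v : 'rV[R[i]]_n) : R :=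
  Num.sqrt (\sum_(k < n) cmod (v ord0 k) ^+ 2).

Definition blen {R : realType} {X : metricType R} (b : X * X) : R :=
  mdist b.1 b.2.

(* A function m : B -> {1, 2, ...} is extended by 0 outside B. *)
Record spectral_geometry (R : realType) (X : metricType R) :=
  SpectralGeometry {
  supp : set (X * X);
  supp_offdiag : forall b, supp b -> b.1 <> b.2;
  supp_sym : forall b, supp b -> supp (swap_pair b);
  supp_finite : forall t : R, 0 < t ->
    finite_set [set b | supp b /\ t <= blen b];
  mult : X * X -> nat;
  mult_supp : forall b, supp b <-> (0 < mult b)%N;
  mult_sym : forall b, mult (swap_pair b) = mult b }.

(* As mult M b = 0 outside supp M, these are exactly the sections on supp M. *)
Definition section (R : realType) (X : metricType R)
    (M : spectral_geometry X) : Type :=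
  forall b : X * X, 'rV[R[i]]_(mult M b).

Section operators.
Context {R : realType} {X : metricType R} (M : spectral_geometry X).
Implicit Types (xi : section M) (a : X -> R[i]) (f rho : X * X -> R).

(* The p-th power of the L^p norm. *)
Definition lp_sum (p : R) xi : \bar R :=
  \esum_(b in supp M) (vnorm (xi b) `^ p)%:E.

Definition in_Lp (p : R) xi : Prop := (lp_sum p xi < +oo)%E.

Definition in_H xi : Prop := in_Lp 2 xi.

Definition H_norm xi : \bar R := poweR (lp_sum 2 xi) 2^-1.

Definition in_A a : Prop :=
  exists L : R, forall x y, cmod (a x - a y) <= L * mdist x y.

Definition pi_op a xi : section M := fun b => a b.1 *: xi b.

(* (f xi(y', y))_{(y, y')}; the cast identifies C^m(y', y) with C^m(y, y'). *)
Definition flip_op f xi : section M := fun b =>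
  (f b)%:C *: castmx (erefl 1%N, mult_sym M b) (xi (swap_pair b)).

Definition ds_op : section M -> section M := flip_op blen.

(* ds is self-adjoint and ds (ds xi) (b) = |b|^2 xi(b), hence |ds| is the
   multiplication by |b|. *)
Definition abs_ds_pow (p : R) xi : section M :=
  fun b => (blen b `^ p)%:C *: xi b.

Definition marked_spectrum rho : Prop :=
  [/\ forall b, supp M b -> 0 < rho b,
      forall b, supp M b -> rho (swap_pair b) = rho b &
      exists c C : R, 0 < c /\
        forall b, supp M b -> c <= rho b / blen b <= C].

Definition ds_rho rho : section M -> section M := flip_op rho.

Definition D_rho rho : section M -> section M :=
  flip_op (fun b => (rho b)^-1).

Definition dom_D rho xi : Prop := in_H xi /\ in_H (D_rho rho xi).

Definition commutator rho a xi : section M :=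
  fun b => D_rho rho (pi_op a xi) b - pi_op a (D_rho rho xi) b.

Definition commutator_norm rho a : \bar R :=
  ereal_sup [set H_norm (commutator rho a xi) | xi in
    [set xi | dom_D rho xi /\ (H_norm xi <= 1)%E]].

Definition connes_metric rho (x x' : X) : \bar R :=
  ereal_sup [set (cmod (a x - a x'))%:E | a in
    [set a | in_A a /\ (commutator_norm rho a <= 1)%E]].

Definition weak_Lp_cvg (p : R) (rho : nat -> X * X -> R)
    (rho0 : X * X -> R) : Prop :=
  forall xi, in_Lp p xi ->
    (fun i => \esum_(b in supp M)
       (`|(rho i b)^-1 - (rho0 b)^-1| `^ p * vnorm (xi b) `^ p)%:E)
      @ \oo --> 0%E.

Definition weak_cvg := weak_Lp_cvg 2.

(* mu_n(T), the n-th largest eigenvalue (from n = 0, counted with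
   multiplicity) of a positive bounded diagonalizable operator T on H, or 0 if
   there are at most n positive ones: the largest t such that t = 0 or H
   contains n + 1 linearly independent eigenvectors with eigenvalues >= t. *)
Definition eigenvalue_seq (T : section M -> section M) (n : nat) : R :=
  sup [set t : R | t = 0 \/
    exists (xi : 'I_n.+1 -> section M) (lam : 'I_n.+1 -> R),
      [/\ forall i, in_H (xi i),
          forall i b, T (xi i) b = (lam i)%:C *: xi i b,
          forall c : 'I_n.+1 -> R[i],
            (forall b, \sum_i c i *: xi i b = 0) -> forall i, c i = 0 &
          forall i, t <= lam i]].

Definition sigma (T : section M -> section M) (N : nat) : R :=
  \sum_(n < N) eigenvalue_seq T n.

End operators.

(* A real dilation-invariant state on bounded sequences extending the limit;
   its values on unbounded sequences are irrelevant. *)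
Record generalized_limit (R : realType) := GeneralizedLimit {
  glim :> (nat -> R) -> R;
  glimD : forall u v : nat -> R, bounded_fun u -> bounded_fun v ->
    glim (fun n => u n + v n) = glim u + glim v;
  glimZ : forall (c : R) (u : nat -> R), bounded_fun u ->
    glim (fun n => c * u n) = c * glim u;
  glim_ge0 : forall u : nat -> R, bounded_fun u ->
    (forall n, 0 <= u n) -> 0 <= glim u;
  glim_lim : forall (u : nat -> R) (l : R), u @ \oo --> l -> glim u = l;
  glim_dilation : forall (k : nat) (u : nat -> R), (0 < k)%N ->
    bounded_fun u -> glim (fun n => u (n %/ k)%N) = glim u }.

Section dimension.
Context {R : realType} {X : metricType R} (M : spectral_geometry X).
Context (omega : generalized_limit R).

(* The terms N = 0, 1, where ln N = 0, do not affect the value. *)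
Definition dixmier_trace (T : section M -> section M) : \bar R :=
  let u := fun N : nat => sigma T N / ln N%:R in
  if `[< bounded_fun u >] then (omega u)%:E else +oo%E.

Definition sg_dim : \bar R :=
  ereal_sup ([set 0%E] `|`
    [set p%:E | p in
      [set p : R | 0 <= p /\ dixmier_trace (abs_ds_pow p) = +oo%E]]).

End dimension.

(* |log (s / t)| for s, t in [0, oo], with |log (oo / oo)| = 0. *)
Definition abs_log_ratio {R : realType} (s t : \bar R) : \bar R :=
  match s, t with
  | EFin r, EFin r' =>
      if (0 < r) && (0 < r') then `|ln (r / r')|%:E else +oo%E
  | EPInf, EPInf => 0%E
  | _, _ => +oo%E
  end.

(* 0 is adjoined because the set is empty when X has at most one point. *)
Definition lipschitz_distance {R : realType} {X : Type}
    (d d' : X -> X -> \bar R) : \bar R :=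
  ereal_sup ([set 0%E] `|`
    [set t | exists x y, x <> y /\ t = abs_log_ratio (d' x y) (d x y)]).

(* Main.v *)
(* If dim M < q < p then sigma_N(|ds|^q) = O(log N); since the k-th largest
   length l_k satisfies k l_k^q <= sigma_k(|ds|^q), this gives
   l_k^p = O(k^-(1+g)) for some g > 0, and the sum of |b|^p over B converges.
   Hence there is a section of L^p whose norm at b is |b|. Testing the weak
   convergence on it bounds |1/rho_i - 1/rho_0| |b| uniformly in b, so that
   rho_i / rho_0 --> 1 uniformly on B. A pointwise bound rho' <= K rho gives
   d_rho' <= K d_rho, and the logarithms of the ratios of the Connes metrics
   are then at most log K. *)
Require Import Defs.
From mathcomp Require Import all_boot all_order all_algebra.
From mathcomp Require Import complex ring lra.
From mathcomp Require finmap.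
From mathcomp Require Import all_classical all_reals all_analysis.
Import numFieldNormedType.Exports.
Set Implicit Arguments.
Unset Strict Implicit.
Unset Printing Implicit Defensive.
Import Order.TTheory GRing.Theory Num.Theory.
Local Open Scope classical_set_scope.
Local Open Scope ring_scope.

(** * Norms of vectors in the fibres *)

Section vnorm.
Context {R : rcfType}.
Local Open Scope complex_scope.
Implicit Types (z : R[i]) (n : nat).

Lemma cmod_ge0 z : 0 <= cmod z.
Proof. by case: z => a b; exact: sqrtr_ge0. Qed.

Lemma cmodM z z' : cmod (z * z') = cmod z * cmod z'.
Proof. exact: ComplexField.Normc.normcM. Qed.

Lemma cmod_real (x : R) : cmod x%:C = `|x|.
Proof. by rewrite /cmod /= expr0n addr0 sqrtr_sqr. Qed.

Lemma vnorm_ge0 n (v : 'rV[R[i]]_n) : 0 <= vnorm v.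
Proof. exact: sqrtr_ge0. Qed.

Lemma vnormZ n z (v : 'rV[R[i]]_n) : vnorm (z *: v) = cmod z * vnorm v.
Proof.
rewrite /vnorm; under eq_bigr => k _ do rewrite mxE cmodM exprMn.
by rewrite -mulr_sumr sqrtrM ?sqr_ge0// sqrtr_sqr ger0_norm ?cmod_ge0.
Qed.

Lemma vnorm0 n : vnorm (0 : 'rV[R[i]]_n) = 0.
Proof. by rewrite -(scale0r 0) vnormZ (cmod_real 0) normr0 mul0r. Qed.

Lemma vnorm_castmx n n' (e : n = n') (v : 'rV[R[i]]_n) :
  vnorm (castmx (erefl 1%N, e) v) = vnorm v.
Proof. by case: n' / e; rewrite castmx_id. Qed.

(** Total in n, including n = 0, because a section also has fibres off the support, where [mult M b]
    = 0. *)
Definition unit_row n : 'rV[R[i]]_n := \row_k ((k == 0 :> nat)%:R)%:C.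

Lemma vnorm_unit_row n : (0 < n)%N -> vnorm (unit_row n) = 1.
Proof.
case: n => // n _; rewrite /vnorm big_ord_recl big1 ?addr0 => [|i _].
  by rewrite mxE cmod_real normr1 expr1n sqrtr1.
by rewrite mxE cmod_real normr0 expr0n.
Qed.

End vnorm.

(** * Comparison of commutator norms and of Connes metrics *)

Lemma esumZ_le {R : realType} {T : choiceType} (S : set T) (a : T -> \bar R)
    (k : R) : 0 <= k -> (forall i, 0 <= a i)%E ->
  (\esum_(i in S) (k%:E * a i) <= k%:E * \esum_(i in S) a i)%E.
Proof.
move=> k0 a0; apply: ge_ereal_sup => _ [A [finA AS] <-].
rewrite -ge0_mule_fsumr//.
by apply: lee_wpmul2l; rewrite ?lee_fin//; apply: ereal_sup_ubound; exists A.
Qed.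

Section comparison.
Context {R : realType} {X : metricType R} (M : spectral_geometry X).
Local Open Scope complex_scope.
Implicit Types (xi eta : section M) (a : X -> R[i]) (f rho : X * X -> R).

Lemma lp_sum_ge0 p xi : (0 <= lp_sum p xi)%E.
Proof. by apply: esum_ge0 => b _; rewrite lee_fin powR_ge0. Qed.

Lemma lp_sum_le (K p : R) xi eta : 0 <= K -> 0 <= p ->
  (forall b, supp M b -> vnorm (xi b) <= K * vnorm (eta b)) ->
  (lp_sum p xi <= (K `^ p)%:E * lp_sum p eta)%E.
Proof.
move=> K0 p0 le_xi; apply: le_trans; last first.
  by apply: esumZ_le => [|b]; rewrite ?powR_ge0// lee_fin powR_ge0.
apply: le_esum => b Bb; rewrite -EFinM lee_fin -powRM ?vnorm_ge0//.
by apply: ge0_ler_powR; rewrite ?nnegrE ?mulr_ge0 ?vnorm_ge0// le_xi.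
Qed.

Lemma H_norm_le (K : R) xi eta : 0 <= K ->
  (forall b, supp M b -> vnorm (xi b) <= K * vnorm (eta b)) ->
  (H_norm xi <= K%:E * H_norm eta)%E.
Proof.
move=> K0 le_xi; have := lp_sum_le K0 (ler0n R 2) le_xi.
have -> : K%:E = poweR (K `^ 2)%:E 2^-1.
  by rewrite poweR_EFin -powRrM divff// powRr1.
rewrite /H_norm -poweRM ?lee_fin ?powR_ge0 ?lp_sum_ge0//.
apply: gt0_ler_poweR; rewrite ?invr_ge0 ?in_itv/= ?leey ?andbT ?lp_sum_ge0//.
by rewrite mule_ge0 ?lp_sum_ge0 ?lee_fin ?powR_ge0.
Qed.

Lemma in_H_le (K : R) xi eta : 0 <= K ->
  (forall b, supp M b -> vnorm (xi b) <= K * vnorm (eta b)) ->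
  in_H eta -> in_H xi.
Proof.
move=> K0 le_xi; rewrite /in_H /in_Lp => eta_fin.
apply: (le_lt_trans (lp_sum_le K0 (ler0n R 2) le_xi)).
by rewrite lte_mul_pinfty// lee_fin powR_ge0.
Qed.

Lemma vnorm_flip f xi b :
  vnorm (flip_op f xi b) = `|f b| * vnorm (xi (swap_pair b)).
Proof. by rewrite vnormZ cmod_real vnorm_castmx. Qed.

Lemma H_norm_flip_le (K : R) f xi : 0 <= K ->
  (forall b, supp M b -> `|f b| <= K) ->
  (H_norm (flip_op f xi) <= K%:E * H_norm xi)%E.
Proof.
move=> K0 fK.
have bij : set_bij (supp M) (supp M) swap_pair.
  split=> [b||b Bb].
  - exact: supp_sym.
  - by move=> b b' _ _; exact: (can_inj swap_pairK).
  - by exists (swap_pair b); [exact: supp_sym|rewrite swap_pairK].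
(* The flip with coefficient 1 only permutes the terms of the sum along the bijection [swap_pair] of
   the support, hence it is an isometry. *)
have lpE : lp_sum 2 xi = lp_sum 2 (flip_op (fun=> 1) xi).
  rewrite /lp_sum (@reindex_esum _ _ _ _ _ _
    (fun b => (vnorm (xi b) `^ 2)%:E) bij).
  by apply: eq_esum => b _; rewrite vnorm_flip normr1 mul1r.
rewrite {2}/H_norm lpE -/(H_norm _).
apply: (H_norm_le K0) => b Bb; rewrite !vnorm_flip normr1 mul1r.
by rewrite ler_wpM2r ?vnorm_ge0 ?fK.
Qed.

(** The flip carries multiplication by a(y) to multiplication by a(y'), so at each b the commutator
    is a scalar multiple of [D_rho]. *)
Lemma commutatorE rho a xi b : commutator rho a xi b =
  (a b.2 - a b.1) *: D_rho rho xi b.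
Proof.
rewrite /commutator /D_rho /flip_op /pi_op /= scalerBl; congr (_ - _).
rewrite scalerA mulrC -scalerA; congr (_ *: _).
by case: _ / (mult_sym M b); rewrite !castmx_id.
Qed.

Lemma vnorm_commutator rho a xi b : vnorm (commutator rho a xi b) =
  cmod (a b.2 - a b.1) * vnorm (D_rho rho xi b).
Proof. by rewrite commutatorE vnormZ. Qed.

Lemma blen_supp_gt0 b : supp M b -> 0 < blen b.
Proof. by move=> Bb; rewrite mdist_gt0; apply/eqP; exact: supp_offdiag Bb. Qed.

Lemma marked_spectrum_gt0 rho b : marked_spectrum M rho -> supp M b ->
  0 < rho b.
Proof. by case=> + _ _; apply. Qed.

Lemma vnorm_D_rho_le (K : R) rho rho' xi b :
  marked_spectrum M rho -> marked_spectrum M rho' -> supp M b ->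
  rho' b <= K * rho b ->
  vnorm (D_rho rho xi b) <= K * vnorm (D_rho rho' xi b).
Proof.
move=> mrho mrho' Bb le_rho; have r0 := marked_spectrum_gt0 mrho Bb.
have r'0 := marked_spectrum_gt0 mrho' Bb.
rewrite !vnorm_flip mulrA ler_wpM2r ?vnorm_ge0//.
rewrite !gtr0_norm ?invr_gt0//.
by rewrite -(ler_pM2r r'0) mulfVK ?gt_eqF// mulrC ler_pdivrMr.
Qed.

(* The coefficient of [D_rho, a] at b is (a(b.2) - a(b.1)) / rho(b), so a
   pointwise comparison of the spectra compares the commutator norms. *)
Lemma commutator_norm_le (K K' : R) rho rho' a : 0 <= K -> 0 <= K' ->
  marked_spectrum M rho -> marked_spectrum M rho' ->
  (forall b, supp M b -> rho' b <= K * rho b) ->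
  (forall b, supp M b -> rho b <= K' * rho' b) ->
  (commutator_norm M rho a <= K%:E * commutator_norm M rho' a)%E.
Proof.
move=> K0 K'0 mrho mrho' le_rho' le_rho.
apply: ge_ereal_sup => _ [xi [[xiH DxiH] xi1] <-].
apply: (@le_trans _ _ (K%:E * H_norm (commutator rho' a xi))%E).
  apply: (H_norm_le K0) => b Bb.
  rewrite [leLHS]vnorm_commutator [X in _ <= K * X]vnorm_commutator.
  by rewrite [leRHS]mulrCA ler_wpM2l ?cmod_ge0// vnorm_D_rho_le// le_rho'.
apply: lee_wpmul2l; rewrite ?lee_fin//; apply: ereal_sup_ubound.
exists xi; last by [].
split; last exact: xi1.
split; first exact: xiH.
(* The reverse bound, by K', puts [xi] into the domain of the operator of [rho']. *)
apply: (in_H_le K'0) DxiH => b Bb.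
by apply: (vnorm_D_rho_le _ mrho' mrho Bb); exact: le_rho.
Qed.

Lemma commutator_normZ_le (c : R) rho a : 0 <= c ->
  (commutator_norm M rho (fun x => (c%:C * a x)%R) <=
   c%:E * commutator_norm M rho a)%E.
Proof.
move=> c0; apply: ge_ereal_sup => _ [xi [xid xi1] <-].
apply: (@le_trans _ _ (c%:E * H_norm (commutator rho a xi))%E).
  apply: (H_norm_le c0) => b Bb.
  rewrite [leLHS]vnorm_commutator [X in _ <= c * X]vnorm_commutator.
  by rewrite -mulrBr cmodM cmod_real ger0_norm// mulrA.
by apply: lee_wpmul2l; rewrite ?lee_fin//; apply: ereal_sup_ubound; exists xi.
Qed.

Lemma connes_metric_le (K K' : R) rho rho' x y : 0 < K -> 0 <= K' ->
  marked_spectrum M rho -> marked_spectrum M rho' ->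
  (forall b, supp M b -> rho' b <= K * rho b) ->
  (forall b, supp M b -> rho b <= K' * rho' b) ->
  (connes_metric M rho' x y <= K%:E * connes_metric M rho x y)%E.
Proof.
move=> K0 K'0 mrho mrho' le_rho' le_rho.
apply: ge_ereal_sup => _ [a [[L aL] a1] <-].
rewrite -lee_pdivrMl//; apply: ereal_sup_ubound.
(* If [a] is admissible for [rho'], then its commutator norm for [rho] is at most K, so a / K is
   admissible for [rho]. *)
exists (fun x => K^-1%:C * a x).
  split.
    exists (K^-1 * L) => z w; rewrite -mulrBr cmodM cmod_real.
    by rewrite gtr0_norm ?invr_gt0// -mulrA ler_pM2l ?invr_gt0.
  have Ki0 : 0 <= K^-1 by rewrite invr_ge0 ltW.
  apply: (le_trans (commutator_normZ_le rho a Ki0)).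
  rewrite lee_pdivrMl// mule1.
  have := commutator_norm_le a (ltW K0) K'0 mrho mrho' le_rho' le_rho.
  move=> /le_trans; apply.
  by rewrite -[leRHS]mule1 lee_pmul2l// lte_fin.
by rewrite -mulrBr cmodM cmod_real gtr0_norm ?invr_gt0// EFinM.
Qed.

(** Makes the Connes metric positive off the diagonal, as logarithms of its ratios require. The test
    function is c times the distance to x: it is c-Lipschitz, so c |b| <= rho(b) bounds its
    commutator coefficients by 1. *)
Lemma connes_metric_ge_dist (c : R) rho x y : 0 < c ->
  marked_spectrum M rho -> (forall b, supp M b -> c * blen b <= rho b) ->
  ((c * mdist x y)%:E <= connes_metric M rho x y)%E.
Proof.
move=> c0 mrho c_le.
pose a z : R[i] := (c * mdist x z)%:C.
have cmodE z w : cmod (a z - a w) = c * `|mdist x z - mdist x w|.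
  by rewrite /a -rmorphB cmod_real -mulrBr normrM gtr0_norm.
have a_lip z w : cmod (a z - a w) <= c * mdist z w.
  rewrite cmodE ler_pM2l// ler_norml; have := metric_triangle x z w.
  by have := metric_triangle x w z; rewrite (metric_sym w z); lra.
apply: ereal_sup_ubound; exists a; last first.
  by rewrite cmodE mdistxx sub0r normrN ger0_norm ?mdist_ge0.
split; first by exists c.
apply: ge_ereal_sup => _ [xi [_ xi1] <-]; apply: le_trans xi1.
(* The modulus of the coefficient of the commutator at b; the commutator has pointwise the same norm
   as the flip with coefficient [f]. *)
pose f b : R := cmod (a b.2 - a b.1) / rho b.
have [f0 f1] : (forall b, supp M b -> 0 <= f b) /\
    (forall b, supp M b -> f b <= 1).
  split=> b Bb; have r0 := marked_spectrum_gt0 mrho Bb.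
    by rewrite divr_ge0 ?cmod_ge0 ?ltW.
  rewrite ler_pdivrMr// mul1r (le_trans (a_lip _ _))//.
  by rewrite metric_sym; exact: c_le.
rewrite -[leRHS]mul1e; apply: (@le_trans _ _ (H_norm (flip_op f xi))).
  rewrite -[leRHS]mul1e; apply: (H_norm_le (K := 1) ler01) => b Bb.
  rewrite vnorm_commutator !vnorm_flip mul1r mulrA /f normrM.
  by rewrite (ger0_norm (cmod_ge0 _)).
apply: (H_norm_flip_le (K := 1) _ ler01) => b Bb.
by rewrite ger0_norm ?f0 ?f1.
Qed.

End comparison.

(** The two bounds force s and t to be infinite together; in that case the value 0 is at most ln K
    because K >= 1. *)
Lemma abs_log_ratio_le {R : realType} (K : R) (s t : \bar R) : 1 <= K ->
  (0 < s)%E -> (0 < t)%E -> (s <= K%:E * t)%E -> (t <= K%:E * s)%E ->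
  (abs_log_ratio s t <= (ln K)%:E)%E.
Proof.
move=> K1; have K0 : 0 < K := lt_le_trans ltr01 K1.
case: s t => [r| |] [r'| |] //=.
- rewrite !lte_fin => r0 r'0; rewrite r0 r'0 /= -!EFinM !lee_fin => h h'.
  rewrite ler_norml -lnV ?posrE//.
  rewrite !ler_ln ?posrE ?divr_gt0 ?invr_gt0//.
  by rewrite ler_pdivlMr// mulrC ler_pdivrMr// mulrC h' ler_pdivrMr// h.
- by move=> *; rewrite lee_fin ln_ge0.
Qed.

(** * Real estimates: the logarithm against powers, and sums of j^-(1+g) *)

Section real_estimates.
Context {R : realType}.

(** Here a ln x = ln(x^a) < x^a. It lets a small power absorb the logarithm in the bound on
    [sigma]. *)
Lemma ln_le_powR (a x : R) : 0 < a -> 0 < x -> ln x <= x `^ a / a.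
Proof.
move=> a0 x0; rewrite ler_pdivlMr// mulrC -ln_powR.
by rewrite ltW// ln_sublinear// powR_gt0.
Qed.

(* Bernoulli's inequality ((x - 1) / x)^-g >= 1 + g / x, multiplied by x^-g. *)
Lemma powR_telescope_le (g x : R) : 0 < g -> 1 < x ->
  g * x `^ (- (1 + g)) <= (x - 1) `^ (- g) - x `^ (- g).
Proof.
move=> g0 x1; have x0 : 0 < x by lra.
have y0 : 0 < x - 1 by lra.
rewrite opprD powRD; last by rewrite (gt_eqF x0) implybT.
rewrite powR_inv1 ?(ltW x0)//.
have -> : (x - 1) `^ (- g) = x `^ (- g) * ((x - 1) / x) `^ (- g).
  rewrite -powRM ?divr_ge0 ?ltW//; congr (_ `^ _).
  by rewrite mulrCA divff ?mulr1// gt_eqF.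
rewrite mulrA mulrC -[X in _ - X]mulr1 -mulrBr ler_wpM2l ?powR_ge0//.
rewrite /powR gt_eqF ?divr_gt0// mulNr lerBrDr.
(* The Bernoulli bound follows from exp u >= 1 + u at u = -g ln((x - 1) / x), together with ln(1 -
   1/x) <= -1/x. *)
apply: le_trans (expR_ge1Dx _); rewrite addrC lerD2l -mulrN ler_pM2l//.
have -> : (x - 1) / x = 1 + - x^-1 by field; rewrite gt_eqF.
rewrite lerNr; apply: le_ln1Dx; rewrite ltrN2 invf_lt1//.
Qed.

Lemma sum_powR_le (g : R) (k : nat) : 0 < g ->
  \sum_(j < k) (j.+1%:R : R) `^ (- (1 + g)) <= 1 + g^-1.
Proof.
move=> g0; case: k => [|k].
  by rewrite big_ord0 addr_ge0// invr_ge0 ltW.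
(* Strengthened for the induction: the subtracted power of k + 1 absorbs each new term by
   telescoping. *)
suff : \sum_(j < k.+1) (j.+1%:R : R) `^ (- (1 + g)) <=
    1 + g^-1 * (1 - k.+1%:R `^ (- g)).
  move=> /le_trans; apply; rewrite lerD2l -[leRHS]mulr1.
  by rewrite ler_wpM2l ?invr_ge0 ?ltW// lerBlDr lerDl powR_ge0.
elim: k => [|k IH]; first by rewrite big_ord1 !powR1 subrr mulr0 addr0.
rewrite big_ord_recr /= (le_trans (lerD IH (lexx _)))// -addrA lerD2l.
rewrite -lerBrDl -mulrBr ler_pdivlMl//.
have := @powR_telescope_le g k.+2%:R g0.
have -> : k.+2%:R - 1 = k.+1%:R :> R by rewrite -natr1 addrK.
rewrite ltr1n => /(_ isT); lra.
Qed.

End real_estimates.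

(** * Summability of |b|^p above the dimension *)

Section summability.
Context {R : realType} {X : metricType R} (M : spectral_geometry X).
Local Open Scope complex_scope.
Implicit Types (xi : section M) (b : X * X).

Lemma supp_mult_neq0 b (v : 'rV[R[i]]_(mult M b)) : v != 0 -> supp M b.
Proof.
move=> v0; apply/mult_supp; move: v0; case: (mult M b) v => // v.
by rewrite (thinmx0 v) eqxx.
Qed.

Definition delta_section b0 : section M :=
  fun b => if b == b0 then unit_row _ else 0.

Lemma unit_row_neq0 n : (0 < n)%N -> unit_row n != 0 :> 'rV[R[i]]_n.
Proof.
move=> n0; apply/eqP => h; have := vnorm_unit_row (R := R) n0.
by rewrite h vnorm0 => /esym/eqP; rewrite oner_eq0.
Qed.

Lemma in_H_delta_section b : in_H (delta_section b).
Proof.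
rewrite /in_H /in_Lp /lp_sum.
apply: (@le_lt_trans _ _
  (\esum_(b' in supp M) (if b' \in [set b] then 1 else 0)%E)%E).
  apply: le_esum => b' Bb'; rewrite /delta_section classical_sets.in_set1.
  case: eqP => [e|_].
    by rewrite vnorm_unit_row ?powR1//; apply/mult_supp.
  by rewrite vnorm0 powR0.
rewrite -esum_mkcondr.
apply: (@le_lt_trans _ _ (\esum_(b' in [set b]) 1)%E).
  rewrite esum_mkcondl; apply: le_esum => c _; case: ifP => //.
by rewrite esum_set1// ltry.
Qed.

(** Only finitely many pairs of the support have length at least 1, so a finite maximum, taken
    together with 1, bounds all lengths. *)
Lemma blen_supp_ub : exists2 D : R, 0 <= D & forall b, supp M b -> blen b <= D.
Proof.
have /finite_seqP[s sE] := supp_finite M (@ltr01 R).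
exists (\big[Num.max/1]_(b <- s) blen b) => [|b Bb].
  by rewrite (le_trans ler01)// bigmax_ge_id.
have [b1|b1] := leP 1 (blen b); last first.
  by rewrite (le_trans (ltW b1))// bigmax_ge_id.
have bs : b \in s by have : [set` s] b by rewrite -sE.
exact: le_bigmax_seq.
Qed.

(** The delta sections at the first n + 1 entries of s are independent eigenvectors, with
    eigenvalues |b|^q >= t^q. *)
Lemma eigenvalue_seq_ge (q t : R) (s : seq (X * X)) n : 0 < q -> 0 <= t ->
  uniq s -> (forall b, b \in s -> supp M b /\ t <= blen b) ->
  (n < size s)%N -> t `^ q <= eigenvalue_seq (@abs_ds_pow _ _ M q) n.
Proof.
move=> q0 t0 us hs ns.
have [D D0 hD] := blen_supp_ub.
(* The sup of an unbounded set is 0, so the eigenvalues must be bounded. *)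
apply: ub_le_sup.
  exists (D `^ q) => u [->|[xi [lam [xiH eig indep le_lam]]]].
    by rewrite powR_ge0.
  have [b xib0] : exists b, xi ord0 b != 0.
    apply: contrapT => /forallNP xi0.
    have {}xi0 b : xi ord0 b = 0 by apply/eqP/negPn/negP; exact: xi0.
    (* If the first eigenvector vanished, it alone would give a nontrivial linear relation. *)
    have := indep (fun i => (i == ord0)%:R) _ ord0.
    rewrite eqxx => h; have : 1 = 0 :> R[i].
      apply: h => b; rewrite big1// => i _.
      by case: eqP => [->|_]; rewrite ?xi0 ?scaler0 ?scale0r.
    by move/eqP; rewrite oner_eq0.
  have Bb := supp_mult_neq0 xib0.
  rewrite (le_trans (le_lam ord0))//.
  (* At a point b where the eigenvector is nonzero, its eigenvalue must equal |b|^q. *)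
  have := eig ord0 b; rewrite /abs_ds_pow => /eqP.
  rewrite -subr_eq0 -scalerBl scaler_eq0 (negPf xib0) orbF -rmorphB.
  move=> /eqP/(congr1 (@complex.Re R)) /= /eqP; rewrite subr_eq0 => /eqP <-.
  by apply: ge0_ler_powR; rewrite ?nnegrE ?mdist_ge0 ?(ltW q0) ?hD.
have [b0 _] : exists b0, b0 \in s.
  by case: s ns {us hs} => // b0 s' _; exists b0; exact: mem_head.
right; pose c (i : 'I_n.+1) := nth b0 s i.
have lt_i (i : 'I_n.+1) : (i < size s)%N by exact: leq_trans ns.
have cs i : supp M (c i) /\ t <= blen (c i) by apply/hs/mem_nth.
exists (fun i => delta_section (c i)), (fun i => blen (c i) `^ q); split.
- by move=> i; exact: in_H_delta_section.
- move=> i b; rewrite /abs_ds_pow /delta_section; case: eqP => [->//|_].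
  by rewrite !scaler0.
- move=> z hz j; have := hz (c j); rewrite (bigD1 j)//= big1 ?addr0.
    move=> /eqP; rewrite scaler_eq0 /delta_section eqxx => /orP[/eqP//|].
    by rewrite (negPf (unit_row_neq0 _))//; apply/mult_supp; exact: (cs j).1.
  move=> i; rewrite eq_sym -val_eqE => ij.
  by rewrite /delta_section nth_uniq// (negPf ij) scaler0.
- move=> i; apply: ge0_ler_powR; rewrite ?nnegrE ?mdist_ge0 ?(ltW q0)//.
  exact: (cs i).2.
Qed.

(** The inequality k l_k^q <= sigma_k, with a duplicate-free list of k pairs of length at least t in
    place of a decreasing enumeration of the lengths. *)
Lemma sigma_ge (q t : R) (s : seq (X * X)) : 0 < q -> 0 <= t ->
  uniq s -> (forall b, b \in s -> supp M b /\ t <= blen b) ->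
  (size s)%:R * t `^ q <= sigma (@abs_ds_pow _ _ M q) (size s).
Proof.
move=> q0 t0 us hs; rewrite mulr_natl -{1}(card_ord (size s)) -sumr_const.
by apply: ler_sum => n _; exact: (eigenvalue_seq_ge q0 t0 us hs).
Qed.

Context (omega : generalized_limit R).

Lemma sigma_le_ln (q : R) :
  (sg_dim M omega < q%:E)%E -> 0 < q ->
  exists2 C : R, 0 <= C & forall N, (1 < N)%N ->
    sigma (@abs_ds_pow _ _ M q) N <= C * ln N%:R.
Proof.
move=> dimq q0.
have : dixmier_trace omega (@abs_ds_pow _ _ M q) <> +oo%E.
  move=> dixq; move: dimq; apply/negP; rewrite -leNgt.
  apply: ereal_sup_ubound; right; exists q => //; split=> //.
  exact: ltW.
rewrite /dixmier_trace; case: asboolP => [bounded _|_ //].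
(* Boundedness supplies a bound for each constant strictly above C; |C| + 1 is one, and it is
   nonnegative. *)
have [C [_ hC]] := bounded; exists (`|C| + 1) => [|N N1].
  by rewrite addr_ge0.
have ltC : C < `|C| + 1 by rewrite (le_lt_trans (ler_norm C))// ltrDl.
have lnN : 0 < ln N%:R :> R by rewrite ln_gt0// ltr1n.
rewrite -ler_pdivrMr//; apply: le_trans (ler_norm _) _.
exact: (hC _ ltC N I).
Qed.

Lemma blen_powR_le (p : R) : (sg_dim M omega < p%:E)%E ->
  exists g C : R, [/\ 0 < g, 0 <= C & forall s t, 0 <= t -> uniq s ->
    (forall b, b \in s -> supp M b /\ t <= blen b) ->
    (0 < size s)%N -> t `^ p <= C * (size s)%:R `^ (- (1 + g))].
Proof.
move=> dimp.
have dim0 : (0 <= sg_dim M omega)%E by apply: ereal_sup_ubound; left.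
(* The midpoint of the dimension and p; it is positive because the dimension is nonnegative. *)
have [q [q0 qp dimq]] : exists q : R,
    [/\ 0 < q, q < p & (sg_dim M omega < q%:E)%E].
  move: dim0 dimp; case: (sg_dim M omega) => [d| |] //.
  rewrite lee_fin lte_fin => d0 dp; exists ((d + p) / 2).
  by split; rewrite ?lte_fin; lra.
have [C0 C00 hC] := sigma_le_ln dimq q0.
have [D D0 hD] := blen_supp_ub.
pose r := p / q; have r1 : 1 < r by rewrite ltr_pdivlMr// mul1r.
have rE : p = q * r by rewrite /r mulrCA divff ?mulr1// gt_eqF.
(* Half of the excess r - 1 goes into g; then a > 0 is the solution of (a - 1) r = -(1 + g). *)
pose g := (r - 1) / 2; pose a := (r - 1) / (2 * r).
have g0 : 0 < g by rewrite divr_gt0// subr_gt0.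
have a0 : 0 < a by rewrite divr_gt0 ?subr_gt0// mulr_gt0//; lra.
have gE : (a - 1) * r = - (1 + g).
  by rewrite /a /g; field; rewrite gt_eqF//; lra.
(* The first summand serves lists with at least two entries; the second serves singletons, where ln
   1 = 0 gives no bound. *)
pose C := C0 / a + D `^ q.
have C_ge0 : 0 <= C by rewrite addr_ge0 ?powR_ge0// divr_ge0// ltW.
exists g, (C `^ r); split=> // [|s t t0 us hs s0]; first exact: powR_ge0.
(* Both sides become r-th powers, which leaves t^q <= C k^(a-1) for k = |s|, that is k t^q <= C
   k^a. *)
rewrite -gE powRrM rE powRrM -powRM ?powR_ge0//.
apply: ge0_ler_powR; rewrite ?nnegrE ?powR_ge0 ?(mulr_ge0 C_ge0) ?powR_ge0//.
  exact: (ltW (lt_trans ltr01 r1)).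
have k0 : 0 < (size s)%:R :> R by rewrite ltr0n.
rewrite powRD; last by rewrite (gt_eqF k0) implybT.
rewrite powR_inv1 ?(ltW k0)// mulrA ler_pdivlMr// mulrC.
have [s1|s1] := ltnP 1 (size s).
  apply: le_trans (sigma_ge q0 t0 us hs) _; apply: le_trans (hC _ s1) _.
  apply: (@le_trans _ _ (C0 / a * (size s)%:R `^ a)).
    by rewrite mulrAC -mulrA ler_wpM2l// ln_le_powR.
  by rewrite ler_wpM2r ?powR_ge0// lerDl powR_ge0.
have -> : size s = 1%N by apply/eqP; rewrite eqn_leq s1.
rewrite powR1 mul1r mulr1; apply: (@le_trans _ _ (D `^ q)); last first.
  by rewrite lerDr divr_ge0// ltW.
apply: ge0_ler_powR; rewrite ?nnegrE ?(ltW q0)//.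
case: s s0 hs {us s1 k0} => // b s _ hs.
by have [Bb /le_trans] := hs b (mem_head _ _); apply; exact: hD.
Qed.

Lemma summable_blen (p : R) : (sg_dim M omega < p%:E)%E ->
  (\esum_(b in supp M) (blen b `^ p)%:E < +oo)%E.
Proof.
move=> dimp; have [g [C [g0 C0 hC]]] := blen_powR_le dimp.
(* The infinite sum is a supremum over finite sets, and the bound depends on a finite set only
   through its size. *)
suff bound s : uniq s -> (forall b, b \in s -> supp M b) ->
    \sum_(b <- s) blen b `^ p <=
    C * \sum_(j < size s) j.+1%:R `^ (- (1 + g)).
  apply: (@le_lt_trans _ _ (C * (1 + g^-1))%:E); last exact: ltry.
  apply: ge_ereal_sup => _ [A [finA AM] <-].
  rewrite fsbig_finite// sumEFin lee_fin.
  apply: le_trans (bound _ _ _) _; first exact: finmap.fset_uniq.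
    by move=> b; rewrite in_fset_set// inE => /AM.
  by rewrite ler_wpM2l// sum_powR_le.
(* Remove the shortest element: if |s| = k then its p-th power is at most
   C k^-(1+g). *)
move: {2}(size s) (erefl (size s)) => k.
elim: k s => [|k IH] s.
  by move=> /size0nil -> _ _; rewrite big_nil big_ord0 mulr0.
move=> sk us sM.
have [b bs bmin] : exists2 b, b \in s & forall c, c \in s -> blen b <= blen c.
  case: s sk {us sM} => // b0 s _.
  have [i _ imin] := @arg_minP _ _ _ (ord0 : 'I_(size s).+1) xpredT
    (fun i => blen (nth b0 (b0 :: s) i)) isT.
  exists (nth b0 (b0 :: s) i); first exact: mem_nth.
  move=> c cs; rewrite -(nth_index b0 cs).
  have ci : (index c (b0 :: s) < size (b0 :: s))%N by rewrite index_mem.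
  exact: (imin (Ordinal ci)).
have sk' : size (rem b s) = k by rewrite size_rem// sk.
rewrite (perm_big _ (perm_to_rem bs)) big_cons sk big_ord_recr /= mulrDr addrC.
apply: lerD.
  rewrite -sk'; apply: IH => //; first exact: rem_uniq.
  by move=> c /mem_rem/sM.
rewrite -sk; apply: hC; rewrite ?sk ?mdist_ge0//.
by move=> c cs; split; [exact: sM|exact: bmin].
Qed.

End summability.

(** * Uniform convergence of the spectra and Lipschitz convergence of the metrics *)

(** Convergence to 0 in the extended reals splits into eventual finiteness and real convergence;
    finitely many terms may be infinite. *)
Lemma cvge0P {R : realType} (u : nat -> \bar R) : (forall n, (0 <= u n)%E) ->
  (u @ \oo --> 0%E) <->
  (forall e : R, 0 < e -> \forall n \near \oo, (u n <= e%:E)%E).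
Proof.
move=> u0; split=> [/fine_cvgP[ufin uc] e e0|h].
  move/cvgrPdist_le: uc => /(_ e e0); apply: filterS2 ufin => n ufin.
  rewrite sub0r normrN /= => le_e.
  by rewrite -(fineK ufin) lee_fin (le_trans (ler_norm _)).
apply/fine_cvgP; split.
  have := h 1 ltr01; apply: filterS => n u1.
  by rewrite ge0_fin_numE// (le_lt_trans u1)// ltry.
apply/cvgrPdist_le => e e0; have := h e e0; apply: filterS => n ue.
have ufin : u n \is a fin_num by rewrite ge0_fin_numE// (le_lt_trans ue)// ltry.
by rewrite sub0r normrN /= ger0_norm ?fine_ge0// -lee_fin fineK.
Qed.

Section convergence.
Context {R : realType} {X : metricType R} (M : spectral_geometry X).
Context (omega : generalized_limit R).
Local Open Scope complex_scope.
Context (rho : nat -> X * X -> R) (rho0 : X * X -> R).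
Context (hrho : forall i, marked_spectrum M (rho i)).
Context (hrho0 : marked_spectrum M rho0).

Lemma lipschitz_distance_le (K : R) rho1 : 1 <= K ->
  marked_spectrum M rho1 ->
  (forall b, supp M b -> rho1 b <= K * rho0 b /\ rho0 b <= K * rho1 b) ->
  (lipschitz_distance (connes_metric M rho1) (connes_metric M rho0) <=
   (ln K)%:E)%E.
Proof.
move=> K1 hrho1 comp; have K0 : 0 < K := lt_le_trans ltr01 K1.
have [le1 le0] : (forall b, supp M b -> rho1 b <= K * rho0 b) /\
    (forall b, supp M b -> rho0 b <= K * rho1 b).
  by split=> b Bb; have [] := comp b Bb.
(* [abs_log_ratio] is infinite at the value 0, so positivity is required; it comes from the lower
   bound on r(b) / |b|. *)
have pos r (x y : X) : marked_spectrum M r -> x <> y ->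
    (0 < connes_metric M r x y)%E.
  move=> mr xy; have [_ _ [c [C [c0 hc]]]] := mr.
  apply: (@lt_le_trans _ _ (c * mdist x y)%:E).
    by rewrite lte_fin mulr_gt0// mdist_gt0; apply/eqP.
  apply: (connes_metric_ge_dist _ _ c0 mr) => b Bb.
  have b0 := blen_supp_gt0 Bb.
  by have /andP[+ _] := hc b Bb; rewrite ler_pdivlMr.
apply: ge_ereal_sup => _ [->|[x [y [xy ->]]]]; first by rewrite lee_fin ln_ge0.
apply: abs_log_ratio_le => //; [exact: pos|exact: pos| |].
  exact: (connes_metric_le x y K0 (ltW K0) hrho1 hrho0 le0 le1).
exact: (connes_metric_le x y K0 (ltW K0) hrho0 hrho1 le1 le0).
Qed.

Lemma weak_Lp_cvg_uniform (p : R) : 0 < p -> (sg_dim M omega < p%:E)%E ->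
  weak_Lp_cvg M p rho rho0 -> forall e : R, 0 < e ->
  \forall i \near \oo, forall b, supp M b ->
    `|(rho i b)^-1 - (rho0 b)^-1| * blen b <= e.
Proof.
move=> p0 dimp cvg_rho e e0.
pose xi : section M := fun b => (blen b)%:C *: unit_row _.
have vnorm_xi b : supp M b -> vnorm (xi b) = blen b.
  move=> Bb; rewrite vnormZ cmod_real vnorm_unit_row; last exact/mult_supp.
  by rewrite mulr1 ger0_norm ?mdist_ge0.
have xi_Lp : in_Lp p xi.
  apply: le_lt_trans (summable_blen dimp).
  by apply: le_esum => b Bb; rewrite vnorm_xi.
pose u i := \esum_(b in supp M)
  (`|(rho i b)^-1 - (rho0 b)^-1| `^ p * vnorm (xi b) `^ p)%:E.
have u_ge0 i : (0 <= u i)%E.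
  by apply: esum_ge0 => b _; rewrite lee_fin mulr_ge0 ?powR_ge0.
have := (cvge0P u_ge0).1 (cvg_rho xi xi_Lp) _ (powR_gt0 p e0).
apply: filterS => i le_e b Bb.
have : (`|(rho i b)^-1 - (rho0 b)^-1| * blen b) `^ p <= e `^ p.
  rewrite powRM ?mdist_ge0// -(vnorm_xi b Bb) -lee_fin.
  (* The term at b is a partial sum of the series of nonnegative terms. *)
  apply: le_trans le_e; apply: esum_ge; exists [set b].
    by split=> // _ ->.
  by rewrite fsbig_set1.
apply: contraTT; rewrite -!ltNge => lt_e.
by apply: gt0_ltr_powR => //; rewrite nnegrE ?mulr_ge0 ?mdist_ge0// ltW.
Qed.

Lemma weak_Lp_cvg_connes (p : R) : 0 < p -> (sg_dim M omega < p%:E)%E ->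
  weak_Lp_cvg M p rho rho0 ->
  (fun i => lipschitz_distance (connes_metric M (rho i))
                               (connes_metric M rho0)) @ \oo --> 0%E.
Proof.
move=> p0 dimp cvg_rho.
apply/cvge0P => [i|e e0]; first by apply: ereal_sup_ubound; left.
pose K := expR e; have K1 : 1 < K by rewrite /K -expR0 ltr_expR.
have [_ _ [c [C [c0 hC]]]] := hrho0.
(* Since C bounds rho0(b) / |b|, this d makes |rho0 / rho_i - 1| at most 1 - 1/K; adding 1 keeps the
   denominator positive. *)
pose d := (1 - K^-1) / (`|C| + 1).
have C1 : 0 < `|C| + 1 by rewrite (le_lt_trans (normr_ge0 C))// ltrDl.
have d0 : 0 < d.
  by rewrite divr_gt0// subr_gt0 invf_lt1// (lt_trans ltr01).
have := weak_Lp_cvg_uniform p0 dimp cvg_rho d0; apply: filterS => i hi.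
rewrite -[e]expRK -/K; apply: lipschitz_distance_le => [||b Bb].
- exact: ltW.
- exact: hrho.
have b0 := blen_supp_gt0 Bb.
have r0 := marked_spectrum_gt0 hrho0 Bb.
have ri := marked_spectrum_gt0 (hrho i) Bb.
have /andP[_ rC] := hC b Bb.
have : `|rho0 b / rho i b - 1| <= 1 - K^-1.
  have -> : rho0 b / rho i b - 1 =
      ((rho i b)^-1 - (rho0 b)^-1) * blen b * (rho0 b / blen b).
    by field; rewrite !gt_eqF.
  rewrite normrM normrM (gtr0_norm b0) (gtr0_norm (divr_gt0 r0 b0)).
  apply: (@le_trans _ _ (d * (`|C| + 1))); last by rewrite mulfVK ?gt_eqF.
  apply: ler_pM; [|exact: (ltW (divr_gt0 r0 b0))|exact: hi|].
    by rewrite mulr_ge0 ?mdist_ge0.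
  by rewrite (le_trans rC)// (le_trans (ler_norm C))// lerDl.
rewrite ler_norml => /andP[lo hi'].
have K0 : 0 < K := lt_trans ltr01 K1.
have KV0 : 0 < K^-1 by rewrite invr_gt0.
split.
  have : K^-1 <= rho0 b / rho i b by lra.
  by rewrite ler_pdivlMr// ler_pdivrMl.
(* The upper bound on rho0 / rho_i is 2 - 1/K, which is at most K because K + 1/K >= 2. *)
rewrite -ler_pdivrMr//; apply: (@le_trans _ _ (2 - K^-1)); first by lra.
rewrite lerBlDr -subr_ge0.
have -> : K + K^-1 - 2 = (K - 1) ^+ 2 / K by field; rewrite gt_eqF.
by rewrite divr_ge0 ?sqr_ge0 ?ltW.
Qed.

End convergence.

Theorem proposition4p8 (R : realType) (omega : generalized_limit R)
    (X : metricType R) (Xcompact : compact [set: X])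
    (M : spectral_geometry X)
    (rho : nat -> X * X -> R) (rho0 : X * X -> R)
    (hrho : forall i, marked_spectrum M (rho i))
    (hrho0 : marked_spectrum M rho0) :
  (forall p : R, 0 < p -> weak_Lp_cvg M p rho rho0 ->
    (sg_dim M omega < p%:E)%E ->
    (fun i => lipschitz_distance (connes_metric M (rho i))
                                 (connes_metric M rho0)) @ \oo --> 0%E) /\
  ((sg_dim M omega < 2%:E)%E -> weak_cvg M rho rho0 ->
    (fun i => lipschitz_distance (connes_metric M (rho i))
                                 (connes_metric M rho0)) @ \oo --> 0%E).
Proof.
split=> [p p0 cvg_rho dimp|dim2 cvg_rho].
  exact: (weak_Lp_cvg_connes hrho hrho0 p0 dimp cvg_rho).
exact: (weak_Lp_cvg_connes hrho hrho0 (ltr0n R 2) dim2 cvg_rho).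
Qed.
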